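(* Let $d,h,q$ be integers with $h\ge 1$ and $d\ge q\ge 0$, and let $P\in\tilde{\mathcal{A}}$ have the following properties: (i) $P$ is a monic polynomial in $a$ of degree $d+h$; (ii) the initial form in (a,b) of $P$ has degree $d$ and is of the form $\rho\,b^{q}P_{d-q}$ with $\rho\in\mathbb{C}^*$, where $P_{d-q}$ is homogeneous of degree $d-q$ in (a,b) and monic in $a$; (iii) modulo $b\tilde{\mathcal{A}}$ one has $P=a^{d+h}$. Then there exist elements $Z$ and $Q$ in $\tilde{\mathcal{A}}$ which are polynomials in $a$ of respective degrees $q+h$ and at most $d-q-1$, with valuations in (a,b) respectively at least $q+1$ and at least $d-q+1$, such that in $\tilde{\mathcal{A}}$ $$(\rho\,b^{q}+Z)(P_{d-q}+Q)=P.$$ Define the (a,b)-modules $E:=\tilde{\mathcal{A}}/\tilde{\mathcal{A}}P$, $F:=\tilde{\mathcal{A}}/\tilde{\mathcal{A}}(P_{d-q}+Q)$ and $I:=\tilde{\mathcal{A}}/\tilde{\mathcal{A}}(\rho\,b^{q}+Z)$. Then there is an exact sequence of (a,b)-modules $$0\to I\to E\to F\to 0$$ of respective ranks $q+h$, $d+h$, $d-q$ (with $I\to E$ induced by right multiplication by $P_{d-q}+Q$ and $E\to F$ the canonical quotient map), and $I$ is the totally irregular part of $E$.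
   Context: $\mathcal{A}=\mathbb{C}\langle a,b\rangle$ is the unital $\mathbb{C}$-algebra generated by $a,b$ with the relation $ab-ba=b^2$; it is graded by the degree in $(a,b)$ ($a$ and $b$ having degree $1$). $\tilde{\mathcal{A}}$ is its completion for the $b$-adic filtration given by the two-sided ideals $b^\nu\mathcal{A}$, $\nu\in\mathbb{N}$. ''Polynomial in $a$'' means polynomial in $a$ with coefficients in $\mathbb{C}[[b]]$ (a polynomial of negative degree is $0$). Writing $X\in\tilde{\mathcal{A}}$ as $X=\sum c_{k,l}b^ka^l$, its valuation in (a,b) is the smallest $k+l$ with $c_{k,l}\ne0$, and its initial form in (a,b) is the homogeneous part of that smallest degree. A homogeneous element $\sum_k c_kb^ka^{m-k}$ of degree $m$ is monic in $a$ if $c_0=1$. An (a,b)-module is a left $\tilde{\mathcal{A}}$-module which is free of finite rank over $\mathbb{C}[[b]]$; the rank is the $\mathbb{C}[[b]]$-rank. It is local if $a^NE\subset bE$ for some integer $N\ge1$, and simple pole if $aE\subset bE$. It is regular if it is isomorphic to a submodule of a simple pole (a,b)-module. A submodule $G\subset E$ is normal if $G\cap bE=bG$. An (a,b)-module $E$ is totally irregular if every $\tilde{\mathcal{A}}$-linear map from $E$ to a simple pole (a,b)-module is zero. The totally irregular part of a local (a,b)-module $E$ is the smallest normal submodule $I\subset E$ such that $E/I$ is regular (it exists and is totally irregular). *)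

(* Defs.v *)
From HB Require Import structures.
From mathcomp Require Import all_boot all_order all_algebra.
From mathcomp Require Import boolp reals complex.

Set Implicit Arguments.
Unset Strict Implicit.
Unset Printing Implicit Defensive.
Import GRing.Theory.
Local Open Scope ring_scope.

(* [atilde K] is the b-adic completion of K<a,b>/(ab - ba = b^2).  Since
   a b^k = b^k a + k b^(k+1), every element has a unique normal form
   X = \sum_k b^k p_k(a) with p_k in K[a]; the degrees of the p_k need not be
   bounded.  [coefb X k] is p_k, so that the scalar c_{k,l} of the expansion
   X = \sum c_{k,l} b^k a^l is (coefb X k)`_l. *)
Record atilde (K : fieldType) := ATilde { coefb : nat -> {poly K} }.
Arguments ATilde {K} _.

Section Algebra.
Variable K : fieldType.
Implicit Types (X Y Z : atilde K) (p q : {poly K}).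

HB.instance Definition _ := gen_eqMixin (atilde K).
HB.instance Definition _ := gen_choiceMixin (atilde K).

Lemma atildeP X Y : (forall k, coefb X k = coefb Y k) -> X = Y.
Proof. by case: X Y => x [y] /= exy; congr ATilde; apply/funext. Qed.

Definition at_zero : atilde K := ATilde (fun=> 0).
Definition at_opp X : atilde K := ATilde (fun k => - coefb X k).
Definition at_add X Y : atilde K := ATilde (fun k => coefb X k + coefb Y k).
Definition at_scale (c : K) X : atilde K := ATilde (fun k => c *: coefb X k).

Fact at_addA : associative at_add.
Proof. by move=> X Y Z; apply: atildeP => k /=; rewrite addrA. Qed.
Fact at_addC : commutative at_add.
Proof. by move=> X Y; apply: atildeP => k /=; rewrite addrC. Qed.
Fact at_add0 : left_id at_zero at_add.
Proof. by move=> X; apply: atildeP => k /=; rewrite add0r. Qed.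
Fact at_addN : left_inverse at_zero at_opp at_add.
Proof. by move=> X; apply: atildeP => k /=; rewrite addNr. Qed.
HB.instance Definition _ :=
  GRing.isZmodule.Build (atilde K) at_addA at_addC at_add0 at_addN.

Fact at_scaleA c d X : at_scale c (at_scale d X) = at_scale (c * d) X.
Proof. by apply: atildeP => k /=; rewrite scalerA. Qed.
Fact at_scale1 : left_id 1 at_scale.
Proof. by move=> X; apply: atildeP => k /=; rewrite scale1r. Qed.
Fact at_scaleDr : right_distributive at_scale +%R.
Proof. by move=> c X Y; apply: atildeP => k /=; rewrite scalerDr. Qed.
Fact at_scaleDl X : {morph at_scale^~ X : c d / c + d}.
Proof. by move=> c d; apply: atildeP => k /=; rewrite scalerDl. Qed.
HB.instance Definition _ := GRing.Zmodule_isLmodule.Build K (atilde K)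
  at_scaleA at_scale1 at_scaleDr at_scaleDl.

Lemma coefbD X Y k : coefb (X + Y) k = coefb X k + coefb Y k. Proof. by []. Qed.
Lemma coefbZ c X k : coefb (c *: X) k = c *: coefb X k. Proof. by []. Qed.
Lemma coefb0 k : coefb (0 : atilde K) k = 0. Proof. by []. Qed.
Lemma coefb_sum I (r : seq I) (P : pred I) (F : I -> atilde K) k :
  coefb (\sum_(i <- r | P i) F i) k = \sum_(i <- r | P i) coefb (F i) k.
Proof. by apply: (big_morph (fun X => coefb X k)). Qed.

(* Left multiplication by a: a (b^k p) = b^k (a p) + k b^(k+1) p.
   (At k = 0 the second summand is multiplied by 0.) *)
Definition amul Y : atilde K :=
  ATilde (fun k => 'X * coefb Y k + coefb Y k.-1 *+ k.-1).

(* Left multiplication by b^i. *)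
Definition bmul (i : nat) Y : atilde K :=
  ATilde (fun k => if (i <= k)%N then coefb Y (k - i) else 0).

(* Left multiplication by p(a), for a polynomial p. *)
Definition pmul (p : {poly K}) Y : atilde K :=
  \sum_(l < size p) p`_l *: iter l amul Y.

(* (\sum_i b^i p_i(a)) Y = \sum_i b^i (p_i(a) Y); only the terms with i <= k
   contribute to the coefficient of b^k. *)
Definition at_mul X Y : atilde K :=
  ATilde (fun k => \sum_(i < k.+1) coefb (bmul i (pmul (coefb X i) Y)) k).

Definition at_one : atilde K := ATilde (fun k => if k == 0%N then 1 else 0).

Fact amul_is_linear : linear amul.
Proof.
move=> c X Y; apply: atildeP => k /=.
by rewrite mulrDr mulrnDl scalerDr scalerMnr scalerAr -!addrA; congr (_ + _); rewrite addrCA.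
Qed.
HB.instance Definition _ :=
  GRing.isLinear.Build K (atilde K) (atilde K) _ amul amul_is_linear.

Fact bmul_is_linear i : linear (bmul i).
Proof.
move=> c X Y; apply: atildeP => k /=.
by case: ifP => //; rewrite scaler0 addr0.
Qed.
HB.instance Definition _ i :=
  GRing.isLinear.Build K (atilde K) (atilde K) _ (bmul i) (bmul_is_linear i).

Lemma iter_amul_is_linear l : linear (iter l amul).
Proof. by elim: l => // l IH c X Y; rewrite !iterS IH linearP. Qed.

Lemma pmul_wide m p Y : (size p <= m)%N ->
  pmul p Y = \sum_(l < m) p`_l *: iter l amul Y.
Proof.
move=> hp; rewrite /pmul (big_ord_widen m (fun l => p`_l *: iter l amul Y) hp).
rewrite big_mkcond /=; apply: eq_bigr => l _; case: ltnP => // /(nth_default 0) ->.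
by rewrite scale0r.
Qed.

Lemma pmul_linl c p q Y : pmul (c *: p + q) Y = c *: pmul p Y + pmul q Y.
Proof.
pose m := maxn (size p) (size q).
have hm : (size (c *: p + q)%R <= m)%N.
  apply: leq_trans (size_polyD _ _) _; rewrite geq_max leq_maxr andbT.
  exact: leq_trans (size_scale_leq _ _) (leq_maxl _ _).
rewrite (pmul_wide Y hm) (pmul_wide Y (leq_maxl (size p) (size q))).
rewrite (pmul_wide Y (leq_maxr (size p) (size q))) scaler_sumr -big_split /=.
by apply: eq_bigr => l _; rewrite coefD coefZ scalerDl scalerA.
Qed.

Lemma pmul_linr c p X Y : pmul p (c *: X + Y) = c *: pmul p X + pmul p Y.
Proof.
rewrite /pmul scaler_sumr -big_split; apply: eq_bigr => l _ /=.
by rewrite iter_amul_is_linear scalerDr !scalerA mulrC.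
Qed.

Lemma pmul0 Y : pmul 0 Y = 0.
Proof. by rewrite /pmul size_poly0 big_ord0. Qed.

Lemma pmulC c Y : pmul c%:P Y = c *: Y.
Proof. by rewrite (pmul_wide Y (size_polyC_leq1 c)) big_ord1 coefC. Qed.

Lemma pmulX p Y : pmul ('X * p) Y = amul (pmul p Y).
Proof.
have hs : (size ('X * p)%R <= (size p).+1)%N.
  by rewrite -[('X * p)%R]commr_polyX; apply: leq_trans (size_polyMleq _ _) _;
     rewrite size_polyX addn2.
rewrite (pmul_wide Y hs) big_ord_recl coefXM eqxx scale0r add0r.
rewrite /pmul linear_sum; apply: eq_bigr => l _.
by rewrite linearZ /= coefXM.
Qed.

Lemma amul_bmul i Y :
  amul (bmul i Y) = bmul i (amul Y) + bmul i.+1 (Y *+ i).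
Proof.
have coefbMn Z n k : coefb (Z *+ n) k = coefb Z k *+ n.
  by elim: n => // n IH; rewrite !mulrS /= IH.
apply: atildeP => -[|k] /=; first by case: i => [|i]; rewrite /= ?mulr0 !mulr0n ?addr0.
rewrite coefbMn; case: (ltngtP i k.+1) => [hik|hik|->].
- rewrite -ltnS hik subSS -addrA subSn //= -mulrnDr.
  by rewrite subnK.
- by rewrite mulr0 leqNgt (ltnW hik) mul0rn !addr0.
- by rewrite ltnn mul0rn subnn mulr0n !addr0.
Qed.

Lemma bmul_bmul i j Y : bmul i (bmul j Y) = bmul (i + j) Y.
Proof.
apply: atildeP => k /=; rewrite subnDA.
case: (leqP i k) => hik; first by rewrite leq_subRL.
by rewrite leqNgt ltn_addr.
Qed.

(* A variant of the product with more terms than needed. *)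
Lemma at_mul_wide m X Y k : (k < m)%N ->
  coefb (at_mul X Y) k = \sum_(i < m) coefb (bmul i (pmul (coefb X i) Y)) k.
Proof.
move=> hk /=.
rewrite (big_ord_widen m (fun i => coefb (bmul i (pmul (coefb X i) Y)) k) hk).
rewrite big_mkcond; apply: eq_bigr => i _ /=; rewrite ltnS.
by case: leqP => // _.
Qed.

Lemma at_mul_linl c X X' Y :
  at_mul (c *: X + X') Y = c *: at_mul X Y + at_mul X' Y.
Proof.
apply: atildeP => k; rewrite /= scaler_sumr -big_split; apply: eq_bigr => i _.
by case: ifP => _; rewrite /= ?scaler0 ?addr0 // pmul_linl.
Qed.

Lemma at_mul_linr c X Y Y' :
  at_mul X (c *: Y + Y') = c *: at_mul X Y + at_mul X Y'.
Proof.
apply: atildeP => k; rewrite /= scaler_sumr -big_split; apply: eq_bigr => i _.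
by case: ifP => _; rewrite /= ?scaler0 ?addr0 // pmul_linr.
Qed.

Lemma at_mul_bmul i X Y : at_mul (bmul i X) Y = bmul i (at_mul X Y).
Proof.
apply: atildeP => k; rewrite [RHS]/=; case: leqP => hik; last first.
  rewrite /= big1 // => j _; case: ifP => // hj; rewrite leqNgt.
  by rewrite (leq_ltn_trans _ hik) -1?ltnS //= pmul0.
have hk : (k < i + (k - i).+1)%N by rewrite addnS subnKC.
rewrite (at_mul_wide _ _ hk) big_split_ord /= big1 ?add0r => [|j _]; last first.
  by rewrite [(i <= j)%N]leqNgt ltn_ord /= pmul0; case: ifP.
apply: eq_bigr => j _.
rewrite leq_addr addKn leq_subRL // subnDA.
by rewrite addnC.
Qed.

Lemma amul_local X Y k : (forall j, (j <= k)%N -> coefb X j = coefb Y j) ->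
  coefb (amul X) k = coefb (amul Y) k.
Proof. by move=> h /=; rewrite !h ?leq_pred. Qed.

Lemma at_mul_amul X Y : at_mul (amul X) Y = amul (at_mul X Y).
Proof.
pose t i := pmul (coefb X i) Y.
apply: atildeP => k; have hk : (k < k.+1)%N by [].
rewrite (at_mul_wide _ _ hk).
have E j : (j < k.+1)%N ->
    coefb (at_mul X Y) j = coefb (\sum_(i < k.+1) bmul i (t i)) j.
  by move=> hj; rewrite (at_mul_wide _ _ hj) coefb_sum.
transitivity (coefb (\sum_(i < k.+1) amul (bmul i (t i))) k); last first.
  rewrite -linear_sum; by apply: amul_local => j hj; rewrite E.
under [in RHS]eq_bigr do rewrite amul_bmul.
rewrite big_split coefbD !coefb_sum.
have hc i : pmul (coefb (amul X) i) Y = amul (t i) + (t i.-1) *+ i.-1.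
  rewrite /= -[X in pmul (X + _)]scale1r pmul_linl scale1r pmulX; congr (_ + _).
  rewrite -scaler_nat -[_ *: _]addr0 pmul_linl scaler_nat.
  by rewrite pmul0 addr0.
under eq_bigr do rewrite hc linearD coefbD.
rewrite big_split; congr (_ + _).
rewrite [LHS]big_ord_recl [RHS]big_ord_recr /= ltnn !add0r addr0.
by apply: eq_bigr => i _; rewrite /bump leq0n add0n add1n ltn_ord.
Qed.

Lemma at_mul_sum I (r : seq I) (F : I -> atilde K) Y :
  at_mul (\sum_(i <- r) F i) Y = \sum_(i <- r) at_mul (F i) Y.
Proof.
apply: (big_morph (fun X => at_mul X Y)) => [X X'|].
  by rewrite -[X]scale1r at_mul_linl !scale1r.
apply: atildeP => k /=; rewrite big1 // => i _.
by rewrite pmul0; case: ifP.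
Qed.

Lemma at_mul_pmul p X Y : at_mul (pmul p X) Y = pmul p (at_mul X Y).
Proof.
rewrite /pmul at_mul_sum; apply: eq_bigr => l _.
rewrite -[_ *: _]addr0 at_mul_linl.
have -> : at_mul 0 Y = 0 by have := at_mul_sum [::] (fun _ : 'I_1 => 0) Y; rewrite !big_nil.
rewrite addr0; congr (_ *: _).
by elim: (l : nat) => //= n IH; rewrite at_mul_amul IH.
Qed.

Fact at_mulA : associative at_mul.
Proof.
move=> X Y Z; apply: atildeP => k.
transitivity (coefb (at_mul (\sum_(i < k.+1) bmul i (pmul (coefb X i) Y)) Z) k).
  rewrite at_mul_sum coefb_sum; apply: eq_bigr => i _.
  by rewrite at_mul_bmul at_mul_pmul.
apply: eq_bigr => i _; congr (coefb (bmul i (pmul _ Z)) k).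
by rewrite (at_mul_wide _ _ (ltn_ord i)) coefb_sum.
Qed.

Fact at_mul1l : left_id at_one at_mul.
Proof.
move=> Y; apply: atildeP => k /=; rewrite big_ord_recl /= subn0.
rewrite -[1]/(1%:P) pmulC scale1r big1 ?addr0 // => i _.
by rewrite pmul0; case: ifP.
Qed.

Lemma iter_amul1 l : iter l amul at_one = ATilde (fun k => if k == 0%N then 'X^l else 0).
Proof.
elim: l => [//|l IH]; rewrite iterS IH.
apply: atildeP => -[|k] /=; first by rewrite mulr0n addr0 exprS.
by rewrite mulr0 add0r; case: k => [|k]; rewrite ?mulr0n ?mul0rn.
Qed.

Lemma pmul1 p : pmul p at_one = ATilde (fun k => if k == 0%N then p else 0).
Proof.
apply: atildeP => k; rewrite /pmul coefb_sum /=.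
under eq_bigr do rewrite iter_amul1 /=.
case: eqP => _; first by rewrite -[in RHS](coefK p) poly_def.
by rewrite big1 // => i _; rewrite scaler0.
Qed.

Fact at_mul1r : right_id at_one at_mul.
Proof.
move=> X; apply: atildeP => k /=; rewrite big_ord_recr /= leqnn pmul1 subnn /=.
rewrite big1 ?add0r // => i _; rewrite pmul1 /=.
by case: ifP => //; rewrite subn_eq0 [(k <= i)%N]leqNgt ltn_ord.
Qed.

Fact at_mulDl : left_distributive at_mul +%R.
Proof. by move=> X X' Y; rewrite -[X]scale1r at_mul_linl !scale1r. Qed.
Fact at_mulDr : right_distributive at_mul +%R.
Proof. by move=> X Y Y'; rewrite -[Y]scale1r at_mul_linr !scale1r. Qed.
Fact at_one_neq0 : at_one != 0.
Proof.
by apply/eqP => /(congr1 (fun X => coefb X 0)) /= /eqP; rewrite oner_eq0.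
Qed.
HB.instance Definition _ := GRing.Zmodule_isNzRing.Build (atilde K)
  at_mulA at_mul1l at_mul1r at_mulDl at_mulDr at_one_neq0.

Fact at_scaleAl c X Y : c *: (X * Y) = c *: X * Y.
Proof. by have := at_mul_linl c X 0 Y; rewrite -[at_mul 0 Y]/(0 * Y) mul0r !addr0. Qed.
HB.instance Definition _ := GRing.Lmodule_isLalgebra.Build K (atilde K) at_scaleAl.
Fact at_scaleAr c X Y : c *: (X * Y) = X * (c *: Y).
Proof. by have := at_mul_linr c X Y 0; rewrite -[at_mul X 0]/(X * 0) mulr0 !addr0. Qed.
HB.instance Definition _ := GRing.Lalgebra_isAlgebra.Build K (atilde K) at_scaleAr.

Definition elt_a : atilde K := ATilde (fun k => if k == 0%N then 'X else 0).
Definition elt_b : atilde K := ATilde (fun k => if k == 1%N then 1 else 0).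

Lemma elt_aE Y : elt_a * Y = amul Y.
Proof.
have -> : elt_a = amul 1.
  apply: atildeP => -[|k] /=; first by rewrite mulr1 mulr0n addr0.
  by rewrite mulr0 add0r; case: k => [|k]; rewrite ?mulr0n ?mul0rn.
by rewrite -[LHS]/(at_mul _ _) at_mul_amul -[at_mul 1 Y]/(1 * Y) mul1r.
Qed.

Lemma elt_bXE i Y : elt_b ^+ i * Y = bmul i Y.
Proof.
have hb Z : elt_b * Z = bmul 1 Z.
  have -> : elt_b = bmul 1 1 by apply: atildeP => -[|[|k]].
  by rewrite -[LHS]/(at_mul _ _) at_mul_bmul -[at_mul 1 Z]/(1 * Z) mul1r.
elim: i => [|i IH]; last by rewrite exprS -mulrA IH hb bmul_bmul.
by rewrite expr0 mul1r; apply: atildeP => k /=; rewrite subn0.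
Qed.

Lemma elt_comm : elt_a * elt_b - elt_b * elt_a = elt_b ^+ 2.
Proof.
apply/eqP; rewrite subr_eq; apply/eqP; rewrite elt_aE.
rewrite -[elt_b in LHS]mulr1 -[elt_b in LHS]expr1 elt_bXE amul_bmul.
by rewrite mulr1n -!elt_bXE expr1 -elt_aE !mulr1 addrC.
Qed.

(* The normal form modulo b^n, and the b-adic filtration; together they say
   that [atilde K] is separated and complete for the latter, with quotients
   spanned by the b^k a^l with k < n. *)
Lemma normal_form_mod n X : exists Y,
  X = \sum_(k < n) elt_b ^+ k *
        (\sum_(l < size (coefb X k)) (coefb X k)`_l *: elt_a ^+ l) + elt_b ^+ n * Y.
Proof.
have hp p : \sum_(l < size p) p`_l *: elt_a ^+ l = pmul p 1.
  apply: eq_bigr => l _; congr (_ *: _).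
  by elim: (l : nat) => //= i IH; rewrite exprS IH elt_aE.
exists (ATilde (fun k => coefb X (k + n))); apply: atildeP => k.
under eq_bigr do rewrite hp elt_bXE pmul1.
rewrite coefbD elt_bXE coefb_sum /=.
case: leqP => hk.
  rewrite subnK // big1 ?add0r // => i _; case: ifP => // _.
  by rewrite subn_eq0 leqNgt (leq_trans (ltn_ord i) hk).
rewrite addr0 (bigD1 (Ordinal hk)) //= leqnn subnn /= big1 ?addr0 // => i hi.
case: ifP => // hik; rewrite subn_eq0; case: ifP => // hki; case/eqP: hi.
by apply: val_inj; apply/eqP; rewrite eqn_leq hik hki.
Qed.

Lemma b_adicP n X :
  (exists Y, X = elt_b ^+ n * Y) <-> (forall k, (k < n)%N -> coefb X k = 0).
Proof.
split=> [[Y ->] k hk|h]; first by rewrite elt_bXE /= leqNgt hk.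
have [Y ->] := normal_form_mod n X; exists Y.
rewrite big1 ?add0r // => k _.
by rewrite h // size_poly0 big_ord0 mulr0.
Qed.

Definition in_Kb X : Prop := forall k l, (0 < l)%N -> (coefb X k)`_l = 0.

(* Polynomials in a with coefficients in K[[b]]; the degree of 0 is [< 0]. *)
Definition a_deg_lt (n : nat) X : Prop :=
  forall k l, (n <= l)%N -> (coefb X k)`_l = 0.
Definition a_deg (n : nat) X : Prop :=
  a_deg_lt n.+1 X /\ exists k, (coefb X k)`_n != 0.
Definition a_monic (n : nat) X : Prop :=
  a_deg_lt n.+1 X /\ forall k, (coefb X k)`_n = (k == 0%N)%:R.

(* The zero element has infinite valuation. *)
Definition val_ge (m : nat) X : Prop :=
  forall k l, (k + l < m)%N -> (coefb X k)`_l = 0.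
Definition val_eq (m : nat) X : Prop :=
  val_ge m X /\ exists k l, (k + l = m)%N /\ (coefb X k)`_l != 0.

Definition homog_part (m : nat) X : atilde K :=
  ATilde (fun k => if (k <= m)%N then (coefb X k)`_(m - k) *: 'X^(m - k) else 0).
Definition homog (m : nat) X : Prop := X = homog_part m X.
Definition homog_monic (m : nat) X : Prop :=
  homog m X /\ (coefb X 0)`_m = 1.

Definition initial_form (m : nat) X Y : Prop :=
  val_eq m X /\ Y = homog_part m X.

End Algebra.

Arguments elt_a {K}.
Arguments elt_b {K}.

Section Quotient.
Variables (R : nzRingType) (E : lmodType R) (G : submodClosed E).

(* The library does not record that a submodule is closed under opposite. *)
Definition submod_zpred : {pred E} := G.
HB.instance Definition _ := GRing.isZmodClosed.Build E submod_zpred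
  (GRing.submod_closedB (submodClosedP G)).

Definition lquot := Quotient.quot submod_zpred.
HB.instance Definition _ := GRing.Zmodule.on lquot.

Definition lquot_proj (x : E) : lquot := \pi_(Quotient.quot submod_zpred)%qT x.
Definition lquot_scale (c : R) (x : lquot) : lquot :=
  lquot_proj (c *: repr (x : Quotient.quot submod_zpred)).

Lemma lquot_projP x y : lquot_proj x = lquot_proj y <-> x - y \in G.
Proof.
rewrite /lquot_proj -[_ \in G]/(_ \in submod_zpred) Quotient.idealrBE.
by split => [->|/eqP].
Qed.

Lemma lquot_proj_surj (x : lquot) : exists y, x = lquot_proj y.
Proof. by exists (repr (x : Quotient.quot submod_zpred)); rewrite /lquot_proj reprK. Qed.

Fact lquot_proj_is_zmod_morphism : zmod_morphism lquot_proj.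
Proof. by move=> x y; rewrite /lquot_proj raddfB. Qed.
HB.instance Definition _ :=
  GRing.isZmodMorphism.Build E lquot lquot_proj lquot_proj_is_zmod_morphism.

Lemma lquot_scaleE c x : lquot_scale c (lquot_proj x) = lquot_proj (c *: x).
Proof.
apply/lquot_projP; rewrite -scalerBr rpredZ //; apply/lquot_projP.
by rewrite /lquot_proj reprK.
Qed.

Fact lquot_scaleA c d x : lquot_scale c (lquot_scale d x) = lquot_scale (c * d) x.
Proof. by have [y ->] := lquot_proj_surj x; rewrite !lquot_scaleE scalerA. Qed.
Fact lquot_scale1 : left_id 1 lquot_scale.
Proof. by move=> x; have [y ->] := lquot_proj_surj x; rewrite lquot_scaleE scale1r. Qed.
Fact lquot_scaleDr : right_distributive lquot_scale +%R.
Proof.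
move=> c x y; have [x' ->] := lquot_proj_surj x; have [y' ->] := lquot_proj_surj y.
by rewrite -raddfD !lquot_scaleE scalerDr raddfD.
Qed.
Fact lquot_scaleDl x : {morph lquot_scale^~ x : c d / c + d}.
Proof.
by move=> c d; have [y ->] := lquot_proj_surj x; rewrite !lquot_scaleE scalerDl raddfD.
Qed.
HB.instance Definition _ := GRing.Zmodule_isLmodule.Build R lquot
  lquot_scaleA lquot_scale1 lquot_scaleDr lquot_scaleDl.

Fact lquot_proj_is_scalable : scalable lquot_proj.
Proof. by move=> c x; rewrite -lquot_scaleE. Qed.
HB.instance Definition _ :=
  GRing.isScalable.Build R E lquot *:%R lquot_proj lquot_proj_is_scalable.

End Quotient.

Section Image.
Variables (R : nzRingType) (E F : lmodType R) (f : {linear E -> F}).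

Definition limage : {pred F} := fun y => `[< exists x, y = f x >].

Fact limage_submod : subsemimod_closed limage.
Proof.
split; first split.
- by apply/asboolP; exists 0; rewrite linear0.
- move=> x y /asboolP[u ->] /asboolP[v ->]; apply/asboolP.
  by exists (u + v); rewrite linearD.
- move=> c x /asboolP[u ->]; apply/asboolP.
  by exists (c *: u); rewrite linearZ.
Qed.
HB.instance Definition _ := GRing.isSubmodClosed.Build R F limage limage_submod.

End Image.

Definition short_exact (R : nzRingType) (A B C : lmodType R)
    (f : {linear A -> B}) (g : {linear B -> C}) : Prop :=
  [/\ injective f, forall z, exists y, g y = z &
      forall y, g y = 0 <-> exists x, y = f x].

Section LeftIdeal.
Variables (K : fieldType) (P : atilde K).

(* The left ideal generated by P, as a submodule of the left regular module. *)
Definition lideal : {pred (atilde K)^o} :=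
  fun X => `[< exists Y : atilde K, X = Y * P :> atilde K >].

Fact lideal_submod : subsemimod_closed lideal.
Proof.
split; first split.
- by apply/asboolP; exists 0; rewrite mul0r.
- move=> x y /asboolP[u ->] /asboolP[v ->]; apply/asboolP.
  by exists (u + v); rewrite mulrDl.
- move=> c x /asboolP[u ->]; apply/asboolP.
  by exists (c * u); rewrite -mulrA.
Qed.
HB.instance Definition _ :=
  GRing.isSubmodClosed.Build (atilde K) (atilde K)^o lideal lideal_submod.

Definition cyclic_mod : lmodType (atilde K) := lquot lideal.
Definition class_mod (X : atilde K) : cyclic_mod :=
  @lquot_proj (atilde K) (atilde K)^o lideal X.

End LeftIdeal.

Section Modules.
Variable K : fieldType.
Implicit Types E : lmodType (atilde K).

(* E is free of rank r over K[[b]], the subring [in_Kb] of [atilde K]. *)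
Definition ab_rank (r : nat) E : Prop :=
  exists e : 'I_r -> E,
    (forall x, exists s : 'I_r -> atilde K,
       (forall i, in_Kb (s i)) /\ x = \sum_i s i *: e i) /\
    (forall s : 'I_r -> atilde K, (forall i, in_Kb (s i)) ->
       \sum_i s i *: e i = 0 -> forall i, s i = 0).

Definition ab_module E : Prop := exists r, ab_rank r E.

Definition ab_local E : Prop :=
  ab_module E /\
  exists N, (0 < N)%N /\ forall x : E, exists y : E, elt_a ^+ N *: x = elt_b *: y.

Definition simple_pole E : Prop :=
  ab_module E /\ forall x : E, exists y : E, elt_a *: x = elt_b *: y.

Definition ab_regular E : Prop :=
  ab_module E /\
  exists S : lmodType (atilde K), simple_pole S /\
  exists (G : submodClosed S) (f : {linear E -> S}),
    injective f /\ forall y, y \in G <-> exists x, y = f x.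

Definition ab_normal E (G : submodClosed E) : Prop :=
  forall x : E, (x \in G /\ exists y, x = elt_b *: y) <->
                (exists y, y \in G /\ x = elt_b *: y).

(* The notion is only considered for a local (a,b)-module E, so that locality
   is part of the assertion. *)
Definition tot_irr_part E (I : submodClosed E) : Prop :=
  [/\ ab_local E, ab_normal I, ab_regular (lquot I) &
      forall J : submodClosed E, ab_normal J -> ab_regular (lquot J) ->
        {subset I <= J}].

End Modules.

(* Main.v *)
Require Import Defs.
From HB Require Import structures.
From mathcomp Require Import all_boot all_order all_algebra.
From mathcomp Require Import boolp reals complex.
From mathcomp Require Import zify.

(* Since the initial form of Pdq is monic in a, one can divide on the right by
   any element with that initial form, and the division respects valuations in
   (a,b).  The two factors are found by (a,b)-adic approximation: dividing the
   error term by Pdq gives the correction of the left factor, while the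
   remainder has degree < d - q in a, hence is divisible by b^q, which gives the
   correction of the right factor.  The approximations of the right factor
   converge in the algebra, and the left factor is then recovered by division.
   The quotient F is regular because b^-1 a is integral over K[[b]] on its
   generator.  On a simple pole module Z raises the b-adic filtration by q + 1,
   so rho b^q + Z acts injectively; hence I has no nonzero map to a simple pole
   module, and it is contained in every J with E/J regular. *)

Set Implicit Arguments.
Unset Strict Implicit.
Unset Printing Implicit Defensive.
Import GRing.Theory.
Local Open Scope ring_scope.

(** * Products and the [b]-adic, (a,b)-adic and [a]-degree filtrations *)

Section Filtrations.
Variable K : fieldType.
Implicit Types (X Y Z P : atilde K) (p : {poly K}).

Lemma coefbN X k : coefb (- X) k = - coefb X k. Proof. by []. Qed.
Lemma coefbB X Y k : coefb (X - Y) k = coefb X k - coefb Y k. Proof. by []. Qed.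

Lemma coefb_bX i Y k :
  coefb (elt_b ^+ i * Y) k = if (i <= k)%N then coefb Y (k - i) else 0.
Proof. by rewrite elt_bXE. Qed.

Lemma coefb_b Y k : coefb (elt_b * Y) k = if k is k'.+1 then coefb Y k' else 0.
Proof. by rewrite -[elt_b]expr1 coefb_bX; case: k => // k; rewrite subn1. Qed.

Lemma coefb_mul X Y k :
  coefb (X * Y) k = \sum_(i < k.+1) coefb (pmul (coefb X i) Y) (k - i).
Proof. by apply: eq_bigr => i _; rewrite /= -ltnS ltn_ord. Qed.

(** Left division by [b^n], exact when the coefficients of index below [n] vanish; in general those
    are dropped. *)
Definition bshift n X : atilde K := ATilde (fun k => coefb X (k + n)).

Lemma bshiftK n X : (forall k, (k < n)%N -> coefb X k = 0) ->
  X = elt_b ^+ n * bshift n X.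
Proof.
move=> h; apply: atildeP => k; rewrite coefb_bX /=.
by case: leqP => hk; [rewrite subnK | rewrite h].
Qed.

Definition aconst p : atilde K := ATilde (fun k => if k == 0%N then p else 0).

Lemma aX l : elt_a ^+ l = aconst 'X^l.
Proof.
rewrite /aconst -iter_amul1.
by elim: l => //= l <-; rewrite exprS elt_aE.
Qed.

Lemma coefb_bXaX i l k :
  coefb (elt_b ^+ i * elt_a ^+ l : atilde K) k = if k == i then 'X^l else 0.
Proof.
rewrite coefb_bX aX /= subn_eq0; case: (ltngtP i k) => //.
Qed.

(** Moving [a] across [b^n] only adds a term in [b^(n+1)], so on the lowest coefficient [p(a)] acts
    by multiplication in [K[a]]. *)
Lemma pmul_low n p Y : (forall j, (j < n)%N -> coefb Y j = 0) ->
  (forall j, (j < n)%N -> coefb (pmul p Y) j = 0) /\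
  coefb (pmul p Y) n = p * coefb Y n.
Proof.
move=> hY; have hl l : (forall j, (j < n)%N -> coefb (iter l (@amul K) Y) j = 0) /\
    coefb (iter l (@amul K) Y) n = 'X^l * coefb Y n.
  elim: l => [|l [IH1 IH2]]; first by rewrite mul1r.
  split=> [j hj|] /=.
    rewrite IH1 // mulr0 add0r IH1 ?mul0rn //; exact: leq_ltn_trans (leq_pred _) hj.
  rewrite IH2 mulrA -exprS; case: n {hY IH2} IH1 => [|n] IH1 /=; first by rewrite mulr0n addr0.
  by rewrite IH1 // mul0rn addr0.
split=> [j hj|]; rewrite /pmul coefb_sum.
  by rewrite big1 // => l _; rewrite coefbZ (hl l).1 // scaler0.
rewrite -[p in RHS]coefK poly_def mulr_suml; apply: eq_bigr => l _.
by rewrite coefbZ (hl l).2 scalerAl.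
Qed.

(* The graded ring of the b-adic filtration is the polynomial ring K[a, b]. *)
Lemma coefb_mul_low m n X Y : (forall i, (i < m)%N -> coefb X i = 0) ->
  (forall j, (j < n)%N -> coefb Y j = 0) ->
  (forall k, (k < m + n)%N -> coefb (X * Y) k = 0) /\
  coefb (X * Y) (m + n) = coefb X m * coefb Y n.
Proof.
move=> hX hY; split=> [k hk|]; rewrite coefb_mul.
  rewrite big1 // => i _; case: (ltnP i m) => hi; first by rewrite hX // pmul0.
  by rewrite (pmul_low _ hY).1 //; move: (ltn_ord i); lia.
have hm : (m < (m + n).+1)%N by lia.
rewrite (bigD1 (Ordinal hm)) //= addKn (pmul_low _ hY).2 big1 ?addr0 // => i hi.
case: (ltnP i m) => him; first by rewrite hX // pmul0.
have {}hi : (i : nat) != m by apply: contraNneq hi => hi; apply/eqP/val_inj.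
by rewrite (pmul_low _ hY).1 //; move: (ltn_ord i); lia.
Qed.

Lemma coefb0M X Y : coefb (X * Y) 0 = coefb X 0 * coefb Y 0.
Proof. by have [//|//|_] := @coefb_mul_low 0 0 X Y. Qed.

(** [K[a]] is a domain, so products of lowest coefficients show successively that the coefficients
    of [X] vanish. *)
Lemma at_mul_eq0l X P : P != 0 -> X * P = 0 -> X = 0.
Proof.
move=> nzP XP0; have [n nzn hn] : exists2 n, coefb P n != 0 &
    forall j, (j < n)%N -> coefb P j = 0.
  have ex : exists n, coefb P n != 0.
    apply: contrapT => h; case/eqP: nzP; apply: atildeP => n.
    by apply/eqP/negPn/negP => hn; case: h; exists n.
  exists (ex_minn ex); first by case: ex_minnP.
  case: ex_minnP => m _ hm j hj; apply/eqP; apply: contraLR hj => /hm.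
  by rewrite -leqNgt.
apply: atildeP => m; elim/ltn_ind: m => m IH.
have [_] := coefb_mul_low IH hn; rewrite XP0 => /esym/eqP.
by rewrite mulf_eq0 (negPf nzn) orbF => /eqP.
Qed.

Lemma val_geB m X Y : val_ge m X -> val_ge m Y -> val_ge m (X - Y).
Proof. by move=> hX hY k l h; rewrite coefbB coefB hX // hY // subr0. Qed.
Lemma val_geN m X : val_ge m X -> val_ge m (- X).
Proof. by move=> hX k l h; rewrite coefbN coefN hX // oppr0. Qed.
Lemma val_geD m X Y : val_ge m X -> val_ge m Y -> val_ge m (X + Y).
Proof. by move=> hX hY k l h; rewrite coefbD coefD hX // hY // addr0. Qed.
Lemma val_geZ m c X : val_ge m X -> val_ge m (c *: X).
Proof. by move=> hX k l h; rewrite coefbZ coefZ hX // mulr0. Qed.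
Lemma val_ge0 m : val_ge m (0 : atilde K).
Proof. by move=> k l _; rewrite coefb0 coef0. Qed.
Lemma val_ge_le m n X : (n <= m)%N -> val_ge m X -> val_ge n X.
Proof. by move=> nm hX k l h; apply: hX; apply: leq_trans nm. Qed.
Lemma val_ge_sum m I (r : seq I) (F : I -> atilde K) :
  (forall i, val_ge m (F i)) -> val_ge m (\sum_(i <- r) F i).
Proof.
by move=> h; apply: (big_ind (val_ge m)) => //; [apply: val_ge0 | apply: val_geD].
Qed.

(** Both terms of [a b^k = b^k a + k b^(k+1)] have total degree [k + 1]. *)
Lemma val_ge_amul m Y : val_ge m Y -> val_ge m.+1 (amul Y).
Proof.
move=> hY k l h /=; rewrite coefD coefXM coefMn.
have -> : (if l == 0%N then 0 else (coefb Y k)`_l.-1) = 0.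
  by case: eqP => // hl; apply: hY; lia.
by rewrite add0r; case: k h => [|k] h //=; rewrite hY ?mul0rn //; lia.
Qed.

Lemma val_ge_pmul m n p Y : (forall l, (l < m)%N -> p`_l = 0) ->
  val_ge n Y -> val_ge (m + n) (pmul p Y).
Proof.
move=> hp hY; apply: val_ge_sum => l; case: (ltnP l m) => hl.
  by rewrite hp // scale0r; apply: val_ge0.
apply: val_geZ; apply: (@val_ge_le (l + n)); first by rewrite leq_add2r.
by elim: (l : nat) => //= i IH; apply: val_ge_amul.
Qed.

Lemma val_geM m n X Y : val_ge m X -> val_ge n Y -> val_ge (m + n) (X * Y).
Proof.
move=> hX hY k l h; rewrite coefb_mul coef_sum big1 // => i _.
have hi := ltn_ord i.
(* The coefficient of [b^i] has order at least [m - i] in [a]; truncated subtraction covers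
   [i > m]. *)
apply: (@val_ge_pmul (m - i) n) => //; last by lia.
by move=> j hj; apply: hX; lia.
Qed.

Lemma val_ge_bX q : val_ge q (elt_b ^+ q : atilde K).
Proof.
move=> k l h; rewrite -[_ ^+ _]mulr1 coefb_bX; by rewrite leqNgt (leq_ltn_trans (leq_addr l k) h) coef0.
Qed.

Lemma val_ge_aconst m p : (forall l, (l < m)%N -> p`_l = 0) -> val_ge m (aconst p).
Proof. by move=> hp [|k] l h /=; [apply: hp; lia | rewrite coef0]. Qed.

Lemma val_ge_bshift m n X : val_ge (n + m) X -> val_ge m (bshift n X).
Proof. by move=> hX k l h; apply: hX; lia. Qed.

Lemma a_deg_lt_bshift m n X : a_deg_lt m X -> a_deg_lt m (bshift n X).
Proof. by move=> hX k l h; apply: hX. Qed.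

Lemma val_ge_eq0 X : (forall m, val_ge m X) -> X = 0.
Proof.
by move=> h; apply: atildeP => k; apply/polyP => l; rewrite coef0 (h (k + l).+1).
Qed.

Lemma a_deg_lt0 m : a_deg_lt m (0 : atilde K).
Proof. by move=> k l _; rewrite coefb0 coef0. Qed.
Lemma a_deg_ltD m X Y : a_deg_lt m X -> a_deg_lt m Y -> a_deg_lt m (X + Y).
Proof. by move=> hX hY k l h; rewrite coefbD coefD hX // hY // addr0. Qed.
Lemma a_deg_ltN m X : a_deg_lt m X -> a_deg_lt m (- X).
Proof. by move=> hX k l h; rewrite coefbN coefN hX // oppr0. Qed.
Lemma a_deg_ltB m X Y : a_deg_lt m X -> a_deg_lt m Y -> a_deg_lt m (X - Y).
Proof. by move=> hX hY; apply: a_deg_ltD => //; apply: a_deg_ltN. Qed.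
Lemma a_deg_ltZ m c X : a_deg_lt m X -> a_deg_lt m (c *: X).
Proof. by move=> hX k l h; rewrite coefbZ coefZ hX // mulr0. Qed.
Lemma a_deg_lt_le m n X : (n <= m)%N -> a_deg_lt n X -> a_deg_lt m X.
Proof. by move=> nm hX k l h; apply: hX; apply: leq_trans h. Qed.

Lemma a_deg_lt_aconst m p : (forall l, (m <= l)%N -> p`_l = 0) -> a_deg_lt m (aconst p).
Proof. by move=> hp [|k] l h /=; [apply: hp; lia | rewrite coef0]. Qed.

Lemma a_deg_lt_amul m Y : a_deg_lt m Y -> a_deg_lt m.+1 (amul Y).
Proof.
move=> hY k l h /=; rewrite coefD coefXM coefMn (hY k.-1) ?mul0rn ?addr0; last by lia.
by case: eqP => // hl; apply: hY; lia.
Qed.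

Lemma a_deg_lt_pmul m n p Y : (forall l, (m <= l)%N -> p`_l = 0) ->
  a_deg_lt n.+1 Y -> a_deg_lt (m + n) (pmul p Y).
Proof.
move=> hp hY; apply: (big_ind (a_deg_lt (m + n))).
- exact: a_deg_lt0.
- exact: a_deg_ltD.
move=> l _; case: (leqP m l) => hl; first by rewrite hp // scale0r; apply: a_deg_lt0.
apply: a_deg_ltZ; apply: (@a_deg_lt_le _ (l + n.+1)); first by lia.
by elim: (l : nat) => //= i IH; apply: a_deg_lt_amul.
Qed.

Lemma a_deg_ltM m n X Y : a_deg_lt m X -> a_deg_lt n.+1 Y ->
  a_deg_lt (m + n) (X * Y).
Proof.
move=> hX hY k l h; rewrite coefb_mul coef_sum big1 // => i _.
by apply: (@a_deg_lt_pmul m n) => // j hj; apply: hX.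
Qed.

Lemma a_deg_lt_bX q : a_deg_lt 1 (elt_b ^+ q : atilde K).
Proof.
move=> k [|l] // _; rewrite -[_ ^+ _]mulr1 coefb_bX; case: leqP => _; last by rewrite coef0.
by rewrite /=; case: eqP => _; rewrite ?coef0 ?coef1.
Qed.

End Filtrations.

(** * Right division by an element whose [b^0] coefficient is [a^k] *)

Section Division.
Variable K : fieldType.
Variables (k : nat) (P : atilde K).
Hypothesis P0 : coefb P 0 = 'X^k.
Implicit Types X Y W : atilde K.

(** Dividing the [b^0] coefficient of [X] by [a^k] means cutting it at degree [k]. What is left is
    divisible by [b] on the left, with quotient [next X]; iterating produces the coefficients of
    [quo] and [rem]. *)
Let quo0 X := drop_poly k (coefb X 0).
Let rem0 X := take_poly k (coefb X 0).
Let next X := bshift 1 (X - aconst (quo0 X) * P - aconst (rem0 X)).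
Let quo X : atilde K := ATilde (fun n => quo0 (iter n next X)).
Let rem X : atilde K := ATilde (fun n => rem0 (iter n next X)).

Let nextE X : X = aconst (quo0 X) * P + aconst (rem0 X) + elt_b * next X.
Proof.
rewrite -[X in X * next _]expr1 -bshiftK => [|[|//] _].
  by rewrite addrACA subrr addr0 addrCA subrr addr0.
rewrite !coefbB coefb0M P0 /= -[coefb X 0 in LHS](poly_take_drop k).
by rewrite addrK subrr.
Qed.

Let unfold0 (F : atilde K -> {poly K}) X :
  ATilde (fun n => F (iter n next X)) =
  aconst (F X) + elt_b * ATilde (fun n => F (iter n next (next X))).
Proof.
apply: atildeP => -[|n]; rewrite coefbD coefb_b /= ?addr0 ?add0r //.
by rewrite -iterSr.
Qed.

Let divE X : X = quo X * P + rem X.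
Proof.
apply/eqP; rewrite -subr_eq0; apply/eqP/atildeP => n.
elim: n X => [|n IH] X.
  rewrite coefbB coefbD coefb0M P0 /=.
  by rewrite [_ * _ + _]addrC poly_take_drop subrr.
(* The first division step cancels, leaving [b] times the same difference for [next X]. *)
rewrite [quo X]unfold0 [rem X]unfold0 [X in X - _]nextE mulrDl.
rewrite [X in _ - X]addrACA opprD addrACA subrr add0r -mulrA -mulrDr -mulrBr.
by rewrite coefb_b IH.
Qed.

(** A noncommutative Weierstrass division. Under the respective hypotheses on [P], each [next]
    lowers the valuation by at most 1 and keeps the degree bound, which gives the last two
    clauses. *)
Lemma at_divP X : exists Y W, [/\ X = Y * P + W, a_deg_lt k W,
  val_ge k P -> forall m, val_ge m X -> val_ge (m - k) Y /\ val_ge m W &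
  a_deg_lt k.+1 P -> forall m, (k <= m)%N -> a_deg_lt m X -> a_deg_lt (m - k) Y].
Proof.
exists (quo X), (rem X); split; first exact: divE.
- by move=> n l hl /=; rewrite /rem0 coef_take_poly ltnNge hl.
- move=> hP m hX; have hI n : val_ge (m - n) (iter n next X).
    elim: n => [|n IH]; first by rewrite subn0.
    rewrite iterS subnS -subn1; move: (m - n)%N (iter n next X) IH => {hX}m Z hZ.
    case: m hZ => [//|m] hZ; rewrite subn1; apply: val_ge_bshift; rewrite add1n.
    apply: val_geB; first apply: val_geB => //.
      apply: (@val_ge_le _ (m.+1 - k + k)%N); first by lia.
      apply: val_geM => //; apply: val_ge_aconst => l hl.
      by rewrite coef_drop_poly hZ //; lia.
    apply: val_ge_aconst => l hl.
    by rewrite coef_take_poly hZ ?if_same //; lia.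
  split=> n l h /=; first by rewrite coef_drop_poly (hI n) //; lia.
  by rewrite coef_take_poly (hI n) ?if_same //; lia.
- move=> hP m km hX n l h /=; have hI : a_deg_lt m (iter n next X).
    elim: n => [//|n IH]; rewrite iterS; move: (iter n next X) IH => {hX}Z hZ.
    apply: a_deg_lt_bshift; apply: a_deg_ltB; first apply: a_deg_ltB => //.
      apply: (@a_deg_lt_le _ _ (m - k + k)%N); first by lia.
      apply: a_deg_ltM => //; apply: a_deg_lt_aconst => j hj.
      by rewrite coef_drop_poly hZ //; lia.
    apply: a_deg_lt_aconst => j hj.
    by rewrite coef_take_poly hZ ?if_same //; lia.
  by rewrite coef_drop_poly hI //; lia.
Qed.

(** Uniqueness of the division: the lowest coefficient of [Y * P] is that of [Y] times [a^k], hence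
    of degree at least [k] unless it is zero. *)
Lemma a_deg_lt_mul_eq0 Y : a_deg_lt k (Y * P) -> Y = 0.
Proof.
move=> h; apply: atildeP => m; elim/ltn_ind: m => m IH.
have [//|_] := @coefb_mul_low K m 0 Y P IH.
rewrite addn0 P0 => E; apply/polyP => l; have := h m (l + k)%N (leq_addl _ _).
by rewrite E coefMXn ltnNge leq_addl addnK coef0.
Qed.

End Division.

(** * Factorization by (a,b)-adic approximation *)

Section Factorization.
Variable K : fieldType.
Implicit Types U V Q D : atilde K.

Lemma coefb0_val k (P : atilde K) : val_ge k P -> a_deg_lt k.+1 P ->
  (coefb P 0)`_k = 1 -> coefb P 0 = 'X^k.
Proof.
move=> vP dP lP; apply/polyP => l; rewrite coefXn.
case: (ltngtP l k) => [lk|kl|->] //; [exact: vP | exact: dP].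
Qed.

Lemma homog_monicP k (P : atilde K) : homog_monic k P ->
  [/\ val_ge k P, a_deg_lt k.+1 P & coefb P 0 = 'X^k].
Proof.
move=> [hP lP]; have vP : val_ge k P.
  move=> i l h; rewrite hP /=; case: leqP => hi; last by rewrite coef0.
  by rewrite coefZ coefXn; case: eqP; [lia | rewrite mulr0].
have dP : a_deg_lt k.+1 P.
  move=> i l h; rewrite hP /=; case: leqP => hi; last by rewrite coef0.
  by rewrite coefZ coefXn; case: eqP; [lia | rewrite mulr0].
by split=> //; apply: coefb0_val.
Qed.

Lemma initial_formP d P Q : initial_form d P Q -> val_ge d.+1 (P - Q :> atilde K).
Proof.
move=> [[vP _] ->] i l h; rewrite coefbB coefB /=.
case: (ltnP (i + l) d) => hl.
  rewrite vP // sub0r; case: leqP => hi; last by rewrite coef0 oppr0.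
  by rewrite coefZ coefXn; case: eqP; [lia | rewrite mulr0 oppr0].
have -> : (i <= d)%N by lia.
have -> : (d - i = l)%N by lia.
by rewrite coefZ coefXn eqxx mulr1 subrr.
Qed.

Variables (k q : nat) (rho : K) (Pk : atilde K).
Hypotheses (rho0 : rho != 0) (vPk : val_ge k Pk) (Pk0 : coefb Pk 0 = 'X^k)
  (dPk : a_deg_lt k.+1 Pk).
Let B := rho *: elt_b ^+ q : atilde K.
Variable P : atilde K.
Hypothesis vP : val_ge (q + k).+1 (P - B * Pk).

(* One step of the (a,b)-adic approximation of the factors: the remainder by Pk
   of the error term, having degree < k in a, is divisible by b^q. *)
Let approx N U Q := [/\ val_ge q.+1 (U - B), val_ge k.+1 Q, a_deg_lt k Q &
  val_ge (q + k + N).+1 (P - U * (Pk + Q))].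

Let approx_step N U Q : approx N U Q ->
  exists U' Q', approx N.+1 U' Q' /\ val_ge (k + N).+1 (Q' - Q).
Proof.
move=> [vU vQ dQ vD]; set D := P - _ in vD.
have [V [W [eD dW vVW _]]] := at_divP Pk0 D.
have [vV vW] := vVW vPk _ vD.
have {}vV : val_ge (q + N).+1 V by apply: val_ge_le vV; lia.
pose T := rho^-1 *: bshift q W.
(* Degree below [k] and valuation above [q + k + N] force every exponent of [b] in [W] to exceed
   [q]. *)
have eW : W = B * T.
  rewrite /B /T -scalerAl -scalerAr scalerA mulfV // scale1r; apply: bshiftK => i hi.
  apply/polyP => l; rewrite coef0; case: (leqP k l) => hl; first exact: dW.
  by apply: vW; lia.
have vT : val_ge (k + N).+1 T.
  by apply/val_geZ/val_ge_bshift; apply: val_ge_le vW; lia.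
have dT : a_deg_lt k T by apply/a_deg_ltZ/a_deg_lt_bshift.
exists (U + V), (Q + T); split; last by rewrite addrC addKr.
split.
- by rewrite addrAC; apply: val_geD => //; apply: val_ge_le vV; lia.
- by apply: val_geD => //; apply: val_ge_le vT; lia.
- exact: a_deg_ltD.
(* The linear terms [V Pk + B T] cancel the old error; each remaining product has valuation at least
   [q + k + N + 2]. *)
have -> : P - (U + V) * (Pk + (Q + T)) = - (V * Q) - (U - B) * T - V * T.
  have {1}-> : P = U * (Pk + Q) + (V * Pk + B * T) by rewrite -eW -eD addrC subrK.
  rewrite !mulrDl mulNr !mulrDr !opprD opprK.
  rewrite [LHS](AC ((2*2)*((1*2)*(1*2))) ((1*5)*(2*6)*(3*8)*(9*(7*4)*10))) /=.
  by rewrite !subrr !add0r.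
apply: val_geB; first apply: val_geB; first apply: val_geN.
- by apply: val_ge_le (val_geM vV vQ); lia.
- by apply: val_ge_le (val_geM vU vT); lia.
- by apply: val_ge_le (val_geM vV vT); lia.
Qed.

(** Only the right factor is taken to the limit. For each [N] an approximate left factor is kept, to
    be compared later with the quotient of [P] by [Pk + Q]. *)
Lemma approx_factor : exists Q, [/\ val_ge k.+1 Q, a_deg_lt k Q &
  forall N, exists U, val_ge (q + k + N).+1 (P - U * (Pk + Q))].
Proof.
have [F hF] : exists F : nat -> atilde K * atilde K, forall N,
    approx N (F N).1 (F N).2 /\ val_ge (k + N).+1 ((F N.+1).2 - (F N).2).
  (* The stage number is stored with the pair, so that dependent choice becomes iteration of one
     map. *)
  pose state := {X : nat * (atilde K * atilde K) | approx X.1 X.2.1 X.2.2}.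
  have step (X : state) : {Y : state | (sval Y).1 = (sval X).1.+1 /\
      val_ge (k + (sval X).1).+1 ((sval Y).2.2 - (sval X).2.2)}.
    apply: cid; case: X => [[N [U Q]] /= hX].
    by have [U' [Q' [h1 h2]]] := approx_step hX; exists (exist _ (N.+1, (U', Q')) h1).
  have h0 : approx 0 B 0.
    split; rewrite ?subrr ?addr0 ?addn0 //; [exact: val_ge0 | exact: val_ge0 | exact: a_deg_lt0].
  pose G N := iter N (fun X => sval (step X)) (exist _ (0%N, (B, 0)) h0).
  have G1 N : (sval (G N)).1 = N.
    by elim: N => //= N IH; have [-> _] := svalP (step (G N)); rewrite IH.
  exists (fun N => (sval (G N)).2) => N; split.
    by have := svalP (G N); rewrite G1.
  suff : val_ge (k + (sval (G N)).1).+1 ((sval (G N.+1)).2.2 - (sval (G N)).2.2).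
    by rewrite G1.
  exact: (svalP (step (G N))).2.
have hF2 N M : (N <= M)%N -> val_ge (k + N).+1 ((F M).2 - (F N).2).
  elim: M => [|M IH]; first by rewrite leqn0 => /eqP ->; rewrite subrr; apply: val_ge0.
  rewrite leq_eqVlt => /orP[/eqP ->|NM]; first by rewrite subrr; apply: val_ge0.
  rewrite -(subrKA (F M).2); apply: val_geD; last exact: IH.
  by apply: val_ge_le (hF M).2; lia.
(* By [hF2] the coefficient of [b^i a^l] is stationary from stage [i + l] on. *)
pose Q : atilde K := ATilde (fun i => \poly_(l < k) (coefb (F (i + l)%N).2 i)`_l).
have QF N : val_ge (k + N).+1 (Q - (F N).2).
  move=> i l h; rewrite coefbB coefB coef_poly.
  case: ltnP => hl; last by have [[_ _ ->]] := hF N; rewrite ?subrr.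
  case: (leqP N (i + l)) => hN.
    by rewrite -coefB -coefbB (hF2 _ _ hN).
  apply/eqP; rewrite -oppr_eq0 opprB -coefB -coefbB (hF2 _ _ (ltnW hN)) //; lia.
exists Q; split.
- rewrite -[Q](subrK (F 0%N).2); apply: val_geD; first by apply: val_ge_le (QF 0%N); lia.
  by have [[]] := hF 0%N.
- by move=> i l h; rewrite coef_poly ltnNge h.
move=> N; exists (F N).1; have [[vU _ _ vD] _] := hF N.
(* Passing to the limit in the right factor changes the error by a product of valuation at least
   [q + (k + N + 1)]. *)
have -> : P - (F N).1 * (Pk + Q) =
   P - (F N).1 * (Pk + (F N).2) - (F N).1 * (Q - (F N).2).
  by rewrite -addrA -opprD -mulrDr -addrA subrKC.
apply: val_geB => //; rewrite -[(F N).1](subrK B).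
have vB : val_ge q B by apply/val_geZ/val_ge_bX.
apply: val_ge_le (val_geM (val_geD (val_ge_le (leqnSn _) vU) vB) (QF N)); lia.
Qed.

(** The left factor is the quotient of [P] by [Pk + Q]. Uniqueness of the division gives both the
    vanishing of the remainder and the valuation of [Z]. *)
Lemma factorization : exists Z Q, [/\ val_ge q.+1 Z, val_ge k.+1 Q, a_deg_lt k Q,
  P = (B + Z) * (Pk + Q) & forall m, (k <= m)%N -> a_deg_lt m P -> a_deg_lt (m - k) (B + Z)].
Proof.
have [Q [vQ dQ hQ]] := approx_factor.
have Pi0 : coefb (Pk + Q) 0 = 'X^k.
  rewrite coefbD Pk0; apply/polyP => l; rewrite coefD.
  case: (leqP k l) => hl; first by rewrite dQ ?addr0.
  by rewrite vQ ?addr0 //; lia.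
have vPi : val_ge k (Pk + Q) by apply: val_geD => //; apply: val_ge_le vQ.
have dPi : a_deg_lt k.+1 (Pk + Q) by apply: a_deg_ltD => //; apply: a_deg_lt_le dQ.
have [U [W [eP dW _ dU]]] := at_divP Pi0 P.
have uniq Y R Y' R' : a_deg_lt k R -> a_deg_lt k R' ->
    Y * (Pk + Q) + R = Y' * (Pk + Q) + R' -> Y = Y' /\ R = R'.
  move=> dR dR' e; have e' : (Y - Y') * (Pk + Q) = R' - R.
    by apply/eqP; rewrite mulrBl subr_eq addrAC eq_sym subr_eq addrC e addrC.
  have /subr0_eq eY : Y - Y' = 0.
    by apply: (a_deg_lt_mul_eq0 Pi0); rewrite e'; apply: a_deg_ltB.
  by split=> //; move: e; rewrite eY => /addrI.
(* For every [m], [W] is also the remainder of some [P - U' (Pk + Q)] of valuation above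
   [q + k + m]. *)
have W0 : W = 0.
  apply: val_ge_eq0 => m; have [U' vU'] := hQ m.
  have [Y [R [eR dR vR _]]] := at_divP Pi0 (P - U' * (Pk + Q)).
  have [_ <-] : U = Y + U' /\ R = W.
    have [] := uniq U W (Y + U') R dW dR; last by move=> ? ->.
    by rewrite -eP mulrDl addrAC -eR subrK.
  by apply: val_ge_le (vR vPi _ vU').2; lia.
exists (U - B), Q; split=> //; last 2 first.
- by rewrite addrCA subrr addr0 eP W0 addr0.
- by rewrite addrCA subrr addr0; exact: dU.
(* [U - B] is the quotient of this element, and division lowers the valuation by at most [k]. *)
have vE : val_ge (q + k).+1 (P - B * (Pk + Q)).
  rewrite mulrDr opprD addrA; apply: val_geB => //.
  have vB : val_ge q B by apply/val_geZ/val_ge_bX.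
  by apply: val_ge_le (val_geM vB vQ); lia.
have [Y [R [eR dR vR _]]] := at_divP Pi0 (P - B * (Pk + Q)).
have [<- _] : Y = U - B /\ R = 0.
  by apply: uniq => //; [exact: a_deg_lt0 | rewrite -eR eP W0 !addr0 mulrBl].
by apply: val_ge_le (vR vPi _ vE).1; lia.
Qed.

End Factorization.

(** * Maps out of quotients, and submodules as modules *)

Section Quotients.
Variables (R : nzRingType) (E F : lmodType R).

Lemma lquot_lift (G : submodClosed E) (phi : {linear E -> F}) :
  (forall x, x \in G -> phi x = 0) ->
  exists psi : {linear lquot G -> F}, forall x, psi (lquot_proj G x) = phi x.
Proof.
move=> hphi; pose f (x : lquot G) := phi (repr (x : Quotient.quot (submod_zpred G))).
have fE x : f (lquot_proj G x) = phi x.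
  apply/eqP; rewrite -subr_eq0 -linearB; apply/eqP/hphi.
  by apply/lquot_projP; rewrite /lquot_proj reprK.
have lf : linear f.
  move=> c x y; have [x' ->] := lquot_proj_surj x; have [y' ->] := lquot_proj_surj y.
  by rewrite -linearP !fE linearP.
pose m := GRing.isLinear.Build R (lquot G) F *:%R f lf.
pose g : {linear lquot G -> F} := HB.pack f m.
by exists g.
Qed.

End Quotients.

Section Submodule.
Variables (R : nzRingType) (E : lmodType R) (G : submodClosed E).

HB.instance Definition _ := GRing.isSubmodClosed.Build R E (submod_zpred G)
  (GRing.submod_closed_semi (submodClosedP G)).

(** Gives the elements of [G] a module type of their own, so that a submodule can be the simple pole
    module in a proof of regularity. *)
Record submodule := Submodule { submodule_val : E; _ : submodule_val \in submod_zpred G }.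
HB.instance Definition _ := [isSub for submodule_val].
HB.instance Definition _ := [Choice of submodule by <:].
HB.instance Definition _ := [SubChoice_isSubLmodule of submodule by <:].

Lemma submodule_corestrict (F : lmodType R) (phi : {linear F -> E}) :
  (forall x, phi x \in G) ->
  exists psi : {linear F -> submodule}, forall x, val (psi x) = phi x.
Proof.
move=> hphi; pose f x : submodule := Submodule (hphi x).
have lf : linear f.
  by move=> c x y; apply: val_inj; rewrite /= linearP.
pose m := GRing.isLinear.Build R F submodule *:%R f lf.
pose g : {linear F -> submodule} := HB.pack f m.
by exists g.
Qed.

End Submodule.

(** * Freeness over [K[[b]]], and the action on simple pole modules *)

Section FreeModules.
Variable K : fieldType.
Implicit Types (E F S : lmodType (atilde K)) (s t : atilde K).

Lemma in_Kb_coefb s k : in_Kb s -> coefb s k = ((coefb s k)`_0)%:P.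
Proof.
by move=> hs; apply/polyP => -[|l]; rewrite coefC //=; apply: hs.
Qed.

Lemma in_KbB s t : in_Kb s -> in_Kb t -> in_Kb (s - t).
Proof. by move=> hs ht k l hl; rewrite coefbB coefB hs // ht // subr0. Qed.

Lemma in_Kb_bX n s : in_Kb s -> in_Kb (elt_b ^+ n * s).
Proof. by move=> hs k l hl; rewrite coefb_bX; case: ifP => _; [apply: hs | rewrite coef0]. Qed.

Lemma coefb_Kb_bXaX s n l i : in_Kb s ->
  coefb (s * (elt_b ^+ n * elt_a ^+ l)) i =
  if (n <= i)%N then (coefb s (i - n))`_0 *: 'X^l else 0.
Proof.
move=> hs; rewrite coefb_mul.
under eq_bigr => j _ do rewrite (in_Kb_coefb _ hs) pmulC coefbZ coefb_bXaX.
case: leqP => hn.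
  have hi : (i - n < i.+1)%N by lia.
  rewrite (bigD1 (Ordinal hi)) //= subKn // eqxx big1 ?addr0 // => j hj.
  have {}hj : (j : nat) != (i - n)%N by apply: contraNneq hj => hj; apply/eqP/val_inj.
  by case: eqP; rewrite ?scaler0 //; move: (ltn_ord j); lia.
rewrite big1 // => j _; case: eqP; rewrite ?scaler0 //; move: (ltn_ord j); lia.
Qed.

(** The weights are meant for [w j = n - j]: over [K[[b]]] the [b^(n-j) a^j] with [j < k] span the
    elements of degree below [k] in [a] and valuation at least [n]. *)
Lemma a_deg_lt_expansion k (w : nat -> nat) (W : atilde K) : a_deg_lt k W ->
  (forall i l, (i < w l)%N -> (coefb W i)`_l = 0) ->
  exists s : 'I_k -> atilde K, (forall j, in_Kb (s j)) /\
    W = \sum_j s j * (elt_b ^+ w j * elt_a ^+ j).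
Proof.
move=> dW vW; pose s j : atilde K := ATilde (fun i => ((coefb W (i + w j))`_j)%:P).
have hs j : in_Kb (s j) by move=> i [|l] //=; rewrite coefC.
exists (fun j : 'I_k => s j); split=> //; apply: atildeP => i.
rewrite coefb_sum; under eq_bigr => j _ do rewrite coefb_Kb_bXaX //= coefC /=.
transitivity (\poly_(j < k) (coefb W i)`_j).
  apply/polyP => l; rewrite coef_poly; case: ltnP => // hl; exact: dW.
rewrite poly_def; apply: eq_bigr => j _; case: leqP => hj; first by rewrite subnK.
by rewrite vW // scale0r.
Qed.

Lemma a_deg_lt_expansion_uniq k (w : nat -> nat) (s : 'I_k -> atilde K) :
  (forall j, in_Kb (s j)) ->
  let W := \sum_j s j * (elt_b ^+ w j * elt_a ^+ j) in
  a_deg_lt k W /\ (W = 0 -> forall j, s j = 0).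
Proof.
move=> hs W; have cW i : coefb W i =
    \poly_(j < k) (if insub j is Some j' then
      if (w j <= i)%N then (coefb (s j') (i - w j))`_0 else 0 else 0).
  rewrite coefb_sum poly_def; apply: eq_bigr => j _.
  by rewrite coefb_Kb_bXaX // valK; case: ifP; rewrite ?scale0r.
split=> [i l hl|W0 j]; first by rewrite cW coef_poly ltnNge hl.
apply: atildeP => i; rewrite (in_Kb_coefb _ (hs j)).
have := congr1 (fun p : {poly K} => p`_j) (cW (i + w j)%N).
by rewrite W0 coef0 coef_poly ltn_ord valK leq_addl addnK => <-.
Qed.

Lemma ab_rank_bX r E (x : E) n : ab_rank r E -> elt_b ^+ n *: x = 0 -> x = 0.
Proof.
move=> [e [gen indep]]; have [s [hs ->]] := gen x.
rewrite scaler_sumr => h0; rewrite big1 // => i _.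
suff -> : s i = 0 by rewrite scale0r.
move: h0; under eq_bigr do rewrite scalerA.
move=> /(indep _ (fun i => in_Kb_bX n (hs i)))/(_ i).
move=> /(congr1 (fun X => coefb X)) h; apply: atildeP => k.
by have := congr1 (fun f => f (k + n)%N) h; rewrite coefb_bX leq_addl addnK.
Qed.

(** The coordinates of [x] in a basis are divisible by every [b^n], hence zero. *)
Lemma ab_rank_separated r E (x : E) : ab_rank r E ->
  (forall n, exists y, x = elt_b ^+ n *: y) -> x = 0.
Proof.
move=> [e [gen indep]]; have [s [hs ->]] := gen x => h.
rewrite big1 // => i _; suff -> : s i = 0 by rewrite scale0r.
apply: atildeP => n; have [y] := h n.+1; have [t [ht ->]] := gen y.
move=> /eqP; rewrite -subr_eq0 scaler_sumr -sumrB.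
under eq_bigr do rewrite scalerA -scalerBl.
move=> /eqP h0.
have := indep _ (fun i => in_KbB (hs i) (in_Kb_bX n.+1 (ht i))) h0 i.
move=> /(congr1 (fun X => coefb X n)); rewrite coefbB coefb_bX ltnn subr0.
by move=> ->.
Qed.

Lemma ab_rank_bij r E F (phi : {linear E -> F}) : injective phi ->
  (forall y, exists x, phi x = y) -> ab_rank r F -> ab_rank r E.
Proof.
move=> inj surj [e [gen indep]].
pose e' i := sval (cid (surj (e i))).
have e'E i : phi (e' i) = e i by rewrite /e'; case: cid.
have sumE (s : 'I_r -> atilde K) : phi (\sum_i s i *: e' i) = \sum_i s i *: e i.
  by rewrite linear_sum; apply: eq_bigr => i _; rewrite linearZ /= e'E.
exists e'; split=> [x|s hs s0].
  have [s [hs xE]] := gen (phi x); exists s; split=> //; apply: inj.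
  by rewrite sumE.
by apply: indep => //; rewrite -sumE s0 linear0.
Qed.

Lemma ab_regular_bij E F (phi : {linear E -> F}) : injective phi ->
  (forall y, exists x, phi x = y) -> ab_regular F -> ab_regular E.
Proof.
move=> inj surj [[r hr] [S [hS [G [f [injf fP]]]]]].
split; first by exists r; apply: (ab_rank_bij inj surj hr).
exists S; split=> //; exists G, (f \o phi); split; first exact: inj_comp.
move=> y; rewrite fP; split=> -[x ->]; last by exists (phi x).
by have [z <-] := surj x; exists z.
Qed.

(* In a simple pole module, a raises the b-adic filtration as b does. *)
Lemma simple_pole_val S m (X : atilde K) (x : S) : simple_pole S -> val_ge m X ->
  exists y, X *: x = elt_b ^+ m *: y.
Proof.
move=> [_ ha] + ; elim: m X => [|m IH] X vX.
  by exists (X *: x); rewrite expr0 scale1r.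
(* The [b^0] coefficient of [X] has no constant term, as the valuation is positive, so [a] factors
   out of it. *)
pose X' := aconst (drop_poly 1 (coefb X 0)).
have eX : X = elt_b * bshift 1 X + elt_a * X'.
  apply: atildeP => -[|i]; rewrite coefbD coefb_b elt_aE /= ?addn1.
    rewrite mulr0n addr0 add0r; apply/polyP => l; rewrite coefXM coef_drop_poly.
    by case: l => [|l] /=; [apply: vX | rewrite addn1].
  by rewrite mulr0 add0r; case: i => [|i]; rewrite ?mulr0n ?mul0rn addr0.
have [y hy] : exists y, bshift 1 X *: x = elt_b ^+ m *: y.
  by apply: IH; apply: val_ge_bshift; rewrite add1n.
have [z hz] : exists z, X' *: x = elt_b ^+ m *: z.
  apply: IH; apply: val_ge_aconst => l hl; rewrite coef_drop_poly.
  by apply: vX; lia.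
(* The last two summands come from [a b^m z = b^m (a z) + m b^(m+1) z] with [a z = b t]. *)
have [t ht] := ha z; exists (y + t + m%:R *: z).
rewrite {1}eX scalerDl -!scalerA hy hz !scalerA -exprS !scalerDr -addrA; congr (_ + _).
have -> : elt_a * elt_b ^+ m = elt_b ^+ m * elt_a + elt_b ^+ m.+1 * m%:R :> atilde K.
  rewrite -[elt_b ^+ m in LHS]mulr1 elt_bXE elt_aE amul_bmul -!elt_bXE.
  by rewrite -elt_aE mulr1.
by rewrite scalerDl -!scalerA ht !scalerA exprSr.
Qed.

(** If [x] lies in [b^n S], then [rho b^q x = - Z x] lies in [b^(q+n+1) S], and cancelling [b^q]
    puts [x] in [b^(n+1) S]. Separation concludes. *)
Lemma simple_pole_kill S q rho (Z : atilde K) (x : S) : simple_pole S ->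
  rho != 0 -> val_ge q.+1 Z -> (rho *: elt_b ^+ q + Z) *: x = 0 -> x = 0.
Proof.
move=> hS rho0 vZ hx; have [[r hr] _] := hS.
apply: (ab_rank_separated hr); elim=> [|n [y hy]].
  by exists x; rewrite expr0 scale1r.
have [z hz] : exists z, (Z * elt_b ^+ n) *: y = elt_b ^+ (q + n).+1 *: z.
  by apply: simple_pole_val => //; rewrite -addSn; apply: val_geM vZ _; apply: val_ge_bX.
exists (- ((rho^-1)%:A *: z)); rewrite hy; apply/eqP; rewrite -subr_eq0; apply/eqP.
apply: (ab_rank_bX (n := q) hr).
have := hx; rewrite hy scalerA mulrDl scalerDl hz -scalerAl -exprD.
move=> /(congr1 (fun v => (rho^-1)%:A *: v)); rewrite scaler0 scalerDr !scalerA.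
rewrite -!scalerAl !mul1r scalerA mulVf // scale1r => <-.
by rewrite scalerN opprK scalerDr !scalerA -!exprD addnS -scalerAr mulr1.
Qed.

End FreeModules.

(** * Cyclic modules: bases, locality and regularity *)

Section CyclicModules.
Variable K : fieldType.
Implicit Types P X Y : atilde K.

Lemma class_mod_eq0 P X : class_mod P X = 0 <-> exists Y, X = Y * P.
Proof.
have -> : 0 = @lquot_proj (atilde K) (atilde K)^o (lideal P) 0 by rewrite linear0.
split=> [/lquot_projP|hX]; last by apply/lquot_projP; rewrite subr0; apply/asboolP.
by rewrite subr0 => /asboolP.
Qed.

Lemma class_modD P X Y : class_mod P (X + Y) = class_mod P X + class_mod P Y.
Proof. exact: (linearD (@lquot_proj (atilde K) (atilde K)^o (lideal P))). Qed.

Lemma class_modB P X Y : class_mod P (X - Y) = class_mod P X - class_mod P Y.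
Proof. exact: (linearB (@lquot_proj (atilde K) (atilde K)^o (lideal P))). Qed.

Lemma class_modM P X Y : class_mod P (X * Y) = X *: class_mod P Y.
Proof. exact: (@lquot_proj_is_scalable (atilde K) (atilde K)^o (lideal P)). Qed.

Lemma class_mod_sum P I (r : seq I) (F : I -> atilde K) :
  class_mod P (\sum_(i <- r) F i) = \sum_(i <- r) class_mod P (F i).
Proof. exact: (linear_sum (@lquot_proj (atilde K) (atilde K)^o (lideal P))). Qed.

Lemma class_mod_surj P (x : cyclic_mod P) : exists X, x = class_mod P X.
Proof. exact: (@lquot_proj_surj (atilde K) (atilde K)^o (lideal P)). Qed.

(** Right multiplication by [T] is left linear, and the hypothesis says that it maps the left ideal
    of [P] into that of [P']. *)
Lemma cyclic_rmul P P' T : (exists U, P * T = U * P') ->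
  exists f : {linear cyclic_mod P -> cyclic_mod P'},
    forall X, f (class_mod P X) = class_mod P' (X * T).
Proof.
move=> [U hU]; pose phi (X : (atilde K)^o) := class_mod P' ((X : atilde K) * T).
have lphi : linear phi.
  by move=> c X Y; rewrite /phi mulrDl -mulrA class_modD class_modM.
pose m := GRing.isLinear.Build (atilde K) (atilde K)^o (cyclic_mod P') *:%R phi lphi.
pose g : {linear (atilde K)^o -> cyclic_mod P'} := HB.pack phi m.
have [|f hf] := @lquot_lift _ _ _ (lideal P) g; last by exists f.
move=> X /asboolP[Y ->]; apply/class_mod_eq0; exists (Y * U).
by rewrite -!mulrA hU.
Qed.

Section Basis.
Variables (k n : nat) (P : atilde K).
Hypotheses (P0 : coefb P 0 = 'X^k) (nP : n = 0%N \/ val_ge k P).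
(** For [n = 0] these are the classes of the [a^j], a basis of the whole module. For larger [n] they
    generate the classes of valuation at least [n], provided that division respects valuations,
    whence [nP]. *)
Let e (j : 'I_k) := class_mod P (elt_b ^+ (n - j) * elt_a ^+ j).

Lemma cyclic_gen X : val_ge n X ->
  exists s, (forall j, in_Kb (s j)) /\ class_mod P X = \sum_j s j *: e j.
Proof.
move=> vX; have [Y [W [eX dW vW _]]] := at_divP P0 X.
have {}vW : val_ge n W by case: nP => [->|hP] //; have [] := vW hP n vX.
have [|s [hs eW]] := a_deg_lt_expansion (w := fun j => (n - j)%N) dW.
  by move=> i l h; apply: vW; lia.
exists s; split=> //; rewrite eX class_modD class_modM.
have -> : class_mod P P = 0 by apply/class_mod_eq0; exists 1; rewrite mul1r.
rewrite scaler0 add0r eW class_mod_sum; apply: eq_bigr => j _.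
by rewrite class_modM.
Qed.

Lemma cyclic_indep s : (forall j, in_Kb (s j)) -> \sum_j s j *: e j = 0 ->
  forall j, s j = 0.
Proof.
move=> hs; under eq_bigr do rewrite -class_modM.
rewrite -class_mod_sum => /class_mod_eq0[Y hY].
have [dW] := a_deg_lt_expansion_uniq (fun j => (n - j)%N) hs; apply.
by rewrite hY (a_deg_lt_mul_eq0 P0 (Y := Y)) ?mul0r // -hY.
Qed.

End Basis.

Lemma cyclic_rank k P : coefb P 0 = 'X^k -> ab_rank k (cyclic_mod P).
Proof.
move=> P0; exists (fun j : 'I_k => class_mod P (elt_b ^+ (0 - j) * elt_a ^+ j)); split.
  by move=> x; have [X ->] := class_mod_surj x; apply: cyclic_gen => //; left.
by move=> s; apply: cyclic_indep.
Qed.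

Lemma cyclic_local k P : (0 < k)%N -> coefb P 0 = 'X^k -> ab_local (cyclic_mod P).
Proof.
move=> k0 P0; split; first by exists k; apply: cyclic_rank.
exists k; split=> // x; have [X ->] := class_mod_surj x.
(* In [cyclic_mod P] the class of [a^k X] is that of [a^k X - X P], whose [b^0] coefficient vanishes
   because [K[a]] is commutative. *)
exists (class_mod P (bshift 1 (elt_a ^+ k * X - X * P))).
rewrite -!class_modM -[X in X * bshift _ _]expr1 -bshiftK => [|[|//] _].
  rewrite class_modB; have -> : class_mod P (X * P) = 0 by apply/class_mod_eq0; exists X.
  by rewrite subr0.
by rewrite coefbB !coefb0M P0 aX /= mulrC subrr.
Qed.

Section ValSubmodule.
Variables (n : nat) (P : atilde K).

Definition val_submod : {pred cyclic_mod P} :=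
  fun x => `[< exists2 X, val_ge n X & x = class_mod P X >].

Fact val_submod_closed : subsemimod_closed val_submod.
Proof.
split; first split.
- apply/asboolP; exists 0; first exact: val_ge0.
  by apply/esym/class_mod_eq0; exists 0; rewrite mul0r.
- move=> x y /asboolP[X hX ->] /asboolP[Y hY ->]; apply/asboolP.
  by exists (X + Y); [apply: val_geD | rewrite class_modD].
- move=> c x /asboolP[X hX ->]; apply/asboolP; exists (c * X); last by rewrite class_modM.
  by rewrite -[n]add0n; apply: val_geM.
Qed.
HB.instance Definition _ :=
  GRing.isSubmodClosed.Build (atilde K) (cyclic_mod P) val_submod val_submod_closed.

End ValSubmodule.
Arguments val_submod : clear implicits.

(** With [n = k - 1], [a] raises the valuation to [n + 1]. The remainder modulo [P] then has degree
    below [k] and valuation at least [n + 1], so it has no [b^0] term, and dividing it by [b] leaves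
    valuation at least [n]. *)
Lemma val_submod_simple_pole k P : coefb P 0 = 'X^k -> val_ge k P ->
  simple_pole (submodule (val_submod k.-1 P)).
Proof.
move=> P0 vP; set n := k.-1.
have hval (x : submodule (val_submod n P)) : exists2 X, val_ge n X & val x = class_mod P X.
  by have /asboolP := valP x.
split.
  have he (j : 'I_k) : class_mod P (elt_b ^+ (n - j) * elt_a ^+ j) \in val_submod n P.
    apply/asboolP; eexists; last by [].
    have nj : (n - j + j = n)%N by move: (ltn_ord j); rewrite /n; lia.
    rewrite -[X in val_ge X]nj.
    apply: val_geM; first exact: val_ge_bX.
    by rewrite aX; apply: val_ge_aconst => l hl; rewrite coefXn; case: eqP => //; lia.
  exists k, (fun j => Submodule (he j)); split=> [x|s hs].
    have [X vX xE] := hval x.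
    have [s [hs hX]] := cyclic_gen P0 (or_intror vP) vX.
    exists s; split=> //; apply: val_inj; rewrite xE hX linear_sum.
    by apply: eq_bigr => j _; rewrite linearZ.
  move=> /(congr1 val); rewrite linear_sum linear0 => h.
  exact: (cyclic_indep P0 hs h).
move=> x; have [X vX xE] := hval x.
have [Y [W [eW dW vW _]]] := at_divP P0 (elt_a * X).
have {}vW : val_ge n.+1 W.
  apply: (vW vP _ _).2; rewrite -add1n; apply: val_geM => //.
  by rewrite -[elt_a]expr1 aX; apply: val_ge_aconst => -[|//]; rewrite coefXn.
have hW : class_mod P (bshift 1 W) \in val_submod n P.
  by apply/asboolP; exists (bshift 1 W) => //; apply: val_ge_bshift; rewrite add1n.
exists (Submodule hW); apply: val_inj; rewrite !linearZ /= xE -!class_modM.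
rewrite -[X in class_mod P (X * bshift _ _)]expr1 -bshiftK => [|[|//] _].
  rewrite eW class_modD -[RHS]add0r; congr (_ + _).
  by apply/class_mod_eq0; exists Y.
apply/polyP => l; rewrite coef0; case: (leqP k l) => hl; first exact: dW.
by apply: vW; rewrite /n; lia.
Qed.

(* The saturation of M = cyclic_mod P by b^-1 a lies in b^-n M, n = k - 1.
   Twisting by b^n turns it into the submodule of classes of valuation at least
   n in cyclic_mod P', where P b^n = b^n P', and the inclusion into right
   multiplication by b^n. *)
Lemma cyclic_regular k P : coefb P 0 = 'X^k -> val_ge k P ->
  ab_regular (cyclic_mod P).
Proof.
move=> P0 vP; split; first by exists k; apply: cyclic_rank.
set n := k.-1; pose P' := bshift n (P * elt_b ^+ n).
have bn : coefb (elt_b ^+ n : atilde K) n = 1.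
  by rewrite -[_ ^+ _]mulr1 coefb_bX leqnn subnn.
have bnl j : (j < n)%N -> coefb (elt_b ^+ n : atilde K) j = 0.
  by rewrite -[_ ^+ _]mulr1 coefb_bX ltnNge => /negPf ->.
(* Lowest coefficients multiply: [P b^n] is divisible by [b^n] on the left, and [P'] keeps the [b^0]
   coefficient [a^k]. *)
have [//|P'l P'n] := @coefb_mul_low K 0 n P (elt_b ^+ n) _ bnl.
have PE : P * elt_b ^+ n = elt_b ^+ n * P' by apply: bshiftK.
have P'0 : coefb P' 0 = 'X^k by rewrite -[LHS]/(coefb (P * elt_b ^+ n) (0 + n)) P'n P0 bn mulr1.
have vP' : val_ge k P'.
  by apply: val_ge_bshift; rewrite addnC; apply: val_geM vP _; apply: val_ge_bX.
exists (submodule (val_submod n P')); split; first exact: val_submod_simple_pole.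
have [|f0 hf0] := @cyclic_rmul P P' (elt_b ^+ n); first by exists (elt_b ^+ n).
have hf0G x : f0 x \in val_submod n P'.
  have [X ->] := class_mod_surj x; rewrite hf0; apply/asboolP.
  exists (X * elt_b ^+ n) => //; rewrite -[n in val_ge n]add0n.
  by apply: val_geM => //; apply: val_ge_bX.
have [f hf] := submodule_corestrict hf0G.
pose G : submodClosed (submodule (val_submod n P')) := limage f.
exists G, f; split; last first.
  by move=> y; split=> [/asboolP|h] //; apply/asboolP.
move=> x y exy; apply/eqP; rewrite -subr_eq0; apply/eqP; have : f0 (x - y) = 0.
  by rewrite -hf linearB exy subrr linear0.
have [X ->] := class_mod_surj (x - y).
(* A representative [W] of degree below [k] suffices: [W b^n] still has degree below [k], so it is a
   multiple of [P'] only if it is zero. *)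
have [Y [W [-> dW _ _]]] := at_divP P0 X.
rewrite class_modD (_ : class_mod P (Y * P) = 0) ?add0r; last by apply/class_mod_eq0; exists Y.
rewrite hf0 => /class_mod_eq0[T eT].
suff -> : W = 0 by apply/class_mod_eq0; exists 0; rewrite mul0r.
apply: (@at_mul_eq0l K _ (elt_b ^+ n)).
  by apply/eqP => b0; have := bn; rewrite b0 coefb0 => /esym/eqP; rewrite oner_eq0.
rewrite eT (a_deg_lt_mul_eq0 P'0 (Y := T)) ?mul0r // -eT -[k]addn0.
by apply: a_deg_ltM => //; apply: a_deg_lt_bX.
Qed.

End CyclicModules.

(** * The exact sequence of a product, and minimality of the image of [I] *)

Section ExactSequence.
Variable K : fieldType.

(** Injectivity on the left is right cancellation of [T]: [X T = Y U T] forces [X = Y U]. *)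
Lemma cyclic_short_exact (U T : atilde K) : T != 0 ->
  exists (f : {linear cyclic_mod U -> cyclic_mod (U * T)})
    (g : {linear cyclic_mod (U * T) -> cyclic_mod T}),
  [/\ forall X, f (class_mod U X) = class_mod (U * T) (X * T),
      forall X, g (class_mod (U * T) X) = class_mod T X & short_exact f g].
Proof.
move=> T0; have [|f fE] := @cyclic_rmul K U (U * T) T; first by exists 1; rewrite mul1r.
have [|g gE] := @cyclic_rmul K (U * T) T 1; first by exists U; rewrite mulr1.
exists f, g; split=> // [X|]; first by rewrite gE mulr1.
split.
- move=> x y exy; apply/eqP; rewrite -subr_eq0; apply/eqP.
  have : f (x - y) = 0 by rewrite linearB exy subrr.
  have [X ->] := class_mod_surj (x - y); rewrite fE => /class_mod_eq0[Y].
  rewrite mulrA => /eqP; rewrite -subr_eq0 -mulrBl => /eqP/(at_mul_eq0l T0)/subr0_eq ->.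
  by apply/class_mod_eq0; exists Y.
- move=> z; have [Z ->] := class_mod_surj z.
  by exists (class_mod (U * T) Z); rewrite gE mulr1.
move=> y; have [Y ->] := class_mod_surj y; rewrite gE mulr1; split.
  by move=> /class_mod_eq0[X ->]; exists (class_mod U X); rewrite fE.
move=> [x]; have [X ->] := class_mod_surj x; rewrite fE => e.
have : g (class_mod (U * T) Y) = g (class_mod (U * T) (X * T)) by rewrite e.
by rewrite !gE !mulr1 => ->; apply/class_mod_eq0; exists X.
Qed.

(** First isomorphism theorem, used to carry regularity from [F] to the quotient of [E] by the image
    of [I]. *)
Lemma short_exact_quot (A B C : lmodType (atilde K)) (f : {linear A -> B})
    (g : {linear B -> C}) : short_exact f g ->
  exists h : {linear lquot (limage f) -> C},
    injective h /\ forall y, exists x, h x = y.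
Proof.
move=> [_ surj ex]; have [|h hE] := @lquot_lift _ _ _ (limage f) g.
  by move=> x /asboolP[y ->]; apply/ex; exists y.
exists h; split=> [x y exy|y]; last first.
  by have [x <-] := surj y; exists (lquot_proj (limage f) x).
have [x' ex'] := lquot_proj_surj x; have [y' ey'] := lquot_proj_surj y.
rewrite ex' ey'; apply/lquot_projP/asboolP/ex.
by apply/eqP; rewrite linearB subr_eq0 -!hE -ex' -ey' exy.
Qed.

(** [C] has no [b]-torsion: if [b y] dies in [C], so does [y], and the kernel is the image of
    [f]. *)
Lemma short_exact_normal (r : nat) (A B C : lmodType (atilde K)) (f : {linear A -> B})
    (g : {linear B -> C}) : short_exact f g -> ab_rank r C -> ab_normal (limage f).
Proof.
move=> [_ _ ex] hC x; split=> [[/asboolP xf [y xy]]|[y [hy ->]]]; last first.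
  by split; [rewrite rpredZ | exists y].
exists y; split=> //; apply/asboolP/ex.
apply: (ab_rank_bX (n := 1) hC); rewrite expr1 -linearZ /= -xy.
exact/ex.
Qed.

(** Embed [E/J] in a simple pole module. The image there of the generator of the cyclic module is
    killed by [rho b^q + Z], hence is zero, so [f] takes its values in [J]. *)
Lemma tot_irr_sub q rho (Z : atilde K) (E : lmodType (atilde K))
    (f : {linear cyclic_mod (rho *: elt_b ^+ q + Z) -> E}) (J : submodClosed E) :
  rho != 0 -> val_ge q.+1 Z -> ab_regular (lquot J) -> {subset limage f <= J}.
Proof.
move=> rho0 vZ [_ [S [hS [G [u [inju _]]]]]] x /asboolP[i ->].
have [X ->] := class_mod_surj i; rewrite -[X]mulr1 class_modM linearZ /= rpredZ //.
set x1 := f _; suff : u (lquot_proj J x1) = 0.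
  rewrite -(linear0 u) => /inju; rewrite -(linear0 (lquot_proj J)) => /lquot_projP.
  by rewrite subr0.
apply: (simple_pole_kill hS rho0 vZ); set U := _ + Z.
have -> : U *: u (lquot_proj J x1) = u (lquot_proj J (f (class_mod U (U * 1)))).
  by rewrite class_modM !linearZ.
rewrite mulr1.
have -> : class_mod U U = 0.
  by apply/class_mod_eq0; exists 1; rewrite mul1r.
by rewrite !linear0.
Qed.

End ExactSequence.

(** * Degrees of the two factors, and the sequence that they define *)

Theorem theorem3p2p4 (R : realType) (d h q : nat)
    (P Pdq : atilde R[i]) (rho : R[i]) :
  (1 <= h)%N -> (q <= d)%N ->
  a_monic (d + h) P ->
  rho != 0 -> homog_monic (d - q) Pdq ->
  initial_form d P (rho *: elt_b ^+ q * Pdq) ->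
  (exists Y : atilde R[i], P - elt_a ^+ (d + h) = elt_b * Y) ->
  exists Z Q : atilde R[i],
    [/\ a_deg (q + h) Z, a_deg_lt (d - q) Q,
        val_ge q.+1 Z, val_ge (d - q).+1 Q &
        (rho *: elt_b ^+ q + Z) * (Pdq + Q) = P] /\
    let E := cyclic_mod P in
    let F := cyclic_mod (Pdq + Q) in
    let I := cyclic_mod (rho *: elt_b ^+ q + Z) in
    [/\ ab_rank (q + h) I, ab_rank (d + h) E & ab_rank (d - q) F] /\
    exists (f : {linear I -> E}) (g : {linear E -> F}),
      [/\ forall X, f (class_mod (rho *: elt_b ^+ q + Z) X) =
                    class_mod P (X * (Pdq + Q)),
          forall X, g (class_mod P X) = class_mod (Pdq + Q) X,
          short_exact f g &
          tot_irr_part (limage f)].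
Proof.
move=> h0 qd [dP _] rho0 hPdq hP [Y hY].
have [vPk dPk Pk0] := homog_monicP hPdq.
have P0 : coefb P 0 = 'X^(d + h).
  have -> : P = elt_a ^+ (d + h) + elt_b * Y by rewrite -hY addrC subrK.
  by rewrite coefbD coefb_b addr0 aX.
have vP : val_ge (q + (d - q)).+1 (P - (rho *: elt_b ^+ q) * Pdq).
  by rewrite subnKC //; apply: initial_formP.
have [Z [Q [vZ vQ dQ PE dU]]] := factorization rho0 vPk Pk0 dPk vP.
have vQ' : val_ge (d - q) Q by apply: val_ge_le vQ.
set U := rho *: elt_b ^+ q + Z in PE dU *.
have vF : val_ge (d - q) (Pdq + Q) by apply: val_geD.
have F0 : coefb (Pdq + Q) 0 = 'X^(d - q).
  apply: coefb0_val => //; first by apply: a_deg_ltD => //; apply: a_deg_lt_le dQ.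
  by rewrite coefbD coefD Pk0 coefXn eqxx dQ ?addr0.
(* Cancel [a^(d-q)] in the [b^0] coefficients of the factorization. *)
have U0 : coefb U 0 = 'X^(q + h).
  apply: (@mulIf _ 'X^(d - q)); first by rewrite -size_poly_eq0 size_polyXn.
  rewrite -{1}F0 -coefb0M -PE P0 -exprD; congr ('X^_); lia.
have nzF : Pdq + Q != 0.
  apply/eqP => e; have := F0; rewrite e coefb0 => /esym/eqP.
  by rewrite -size_poly_eq0 size_polyXn.
exists Z, Q; split.
  split=> //; split.
    have -> : Z = U - rho *: elt_b ^+ q by rewrite /U addrC addKr.
    apply: a_deg_ltB; last by apply/a_deg_ltZ/a_deg_lt_le/a_deg_lt_bX.
    have -> : (q + h).+1 = ((d + h).+1 - (d - q))%N by lia.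
    by apply: dU dP; lia.
  (* The term [a^(q+h)] of [U] survives in [Z], since [rho b^q] has degree 0 in [a] and
     [q + h > 0]. *)
  exists 0%N; have -> : Z = U - rho *: elt_b ^+ q by rewrite /U addrC addKr.
  rewrite coefbB coefB U0 coefXn eqxx (a_deg_ltZ _ (a_deg_lt_bX _ q)) ?subr0 ?oner_eq0 //.
  lia.
have rF := cyclic_rank F0; have rE := cyclic_rank P0; have rI := cyclic_rank U0.
split; first by [].
have lE : ab_local (cyclic_mod P) by apply: cyclic_local P0; lia.
(* [P] becomes the product itself, so that the exact sequence of a product applies with [E] as its
   middle term. *)
move: rE lE; rewrite {P0 hP vP dP hY} PE => rE lE.
have [f [g [fE gE fg]]] := cyclic_short_exact U nzF.
exists f, g; split=> //; split=> //.
- exact: short_exact_normal fg rF.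
- have [u [inju surju]] := short_exact_quot fg.
  exact: ab_regular_bij inju surju (cyclic_regular F0 vF).
by move=> J _ rJ; apply: tot_irr_sub.
Qed.
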